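(* For any $k\ge 2$ groups of agents with arbitrary monotonic utilities, there exists an allocation that is $1/k$-democratic EF2.
   Context: There is a finite set $G$ of goods and $k$ groups $A_1,\dots,A_k$ with $n_i\ge1$ agents in $A_i$. Each agent has a utility $u_a:2^G\to\mathbb{R}_{\ge0}$ that is monotone ($X\subseteq Y\Rightarrow u_a(X)\le u_a(Y)$). An allocation is a partition $(G_1,\dots,G_k)$ of $G$; agents of $A_i$ get $u_a(G_i)$. It is EF2 for $a\in A_i$ if for every $i'$ there is $C\subseteq G_{i'}$ with $|C|\le 2$ and $u_a(G_i)\ge u_a(G_{i'}\setminus C)$. An allocation is $1/k$-democratic EF2 if for each $i$ at least $n_i/k$ agents of $A_i$ find it EF2. *)

(* Defs.v *)
From HB Require Import structures.
From mathcomp Require Import all_boot all_order all_algebra.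
Set Implicit Arguments. Unset Strict Implicit. Unset Printing Implicit Defensive.
Import Order.TTheory GRing.Theory Num.Theory.

Local Open Scope ring_scope.

(* An allocation of the goods G among k groups is a function assigning each good
   to a group; bundle i is the preimage of i.  This is exactly a partition
   (G_1,...,G_k) of G (bundles may be empty). *)
Definition bundle (G : finType) (k : nat) (alloc : G -> 'I_k) (i : 'I_k) : {set G} :=
  [set g | alloc g == i].

Definition monotone_util (R : numDomainType) (G : finType) (u : {set G} -> R) : Prop :=
  forall X Y : {set G}, X \subset Y -> u X <= u Y.

Definition EF2 (R : numDomainType) (G : finType) (k : nat) (u : {set G} -> R)
    (alloc : G -> 'I_k) (i : 'I_k) : bool :=
  [forall i' : 'I_k, exists C : {set G},
    [&& C \subset bundle alloc i', (#|C| <= 2)%N &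
        u (bundle alloc i' :\: C) <= u (bundle alloc i)]].

(* 1/k-democratic EF2: for each group i, at least n_i/k of its agents find the
   allocation EF2; stated multiplicatively: k * #{EF2 agents of A_i} >= n_i. *)
Definition democratic_EF2 (R : numDomainType) (G : finType) (k : nat)
    (n : 'I_k -> nat) (u : forall i : 'I_k, 'I_(n i) -> {set G} -> R)
    (alloc : G -> 'I_k) : Prop :=
  forall i : 'I_k, (n i <= k * #|[set a : 'I_(n i) | EF2 (u i a) alloc i]|)%N.

(* Main.v *)
Require Import Defs.
From mathcomp Require Import all_boot all_order all_fingroup all_algebra zify.
Import Order.TTheory GRing.Theory Num.Theory.

(** Put the goods on a line and cut it into [k] pieces with [k - 1] knives that may
    also stop in the middle of a good, which is then lost. The positions of the knives
    are lattice points of a simplex, triangulated by cells in which each knife moves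
    once by half a good. Each lattice point is owned by one group so that every cell has
    one vertex of each owner, and is labelled with a piece that is a favourite of at
    least [n_i / k] agents of its owner. A Sperner cell, on which all labels differ,
    gives group [i] the piece it chose at its own vertex. Rounding each knife to the
    unique boundary between goods that it visits in this cell adds to every piece at
    most one good at each end, whence EF2.

    Sperner's lemma follows by counting doors modulo 2: the parity of the number of
    fully labelled cells only depends on the labels on the boundary of the simplex. The
    boundary labels are changed to those of the labelling [first_big], which has exactly
    one fully labelled cell. *)

(** * Parity of the number of doors of one cell *)

Lemma odd_card_involution (T : finType) (A : {set T}) (g : T -> T) :
  {in A, forall x, [/\ g x \in A, g (g x) = x & g x != x]} -> ~~ odd #|A|.
Proof.
move: {2}#|A| (leqnn #|A|) => m; elim: m A => [|m IHm] A leAm gA.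
  by move: leAm; rewrite leqn0 => /eqP->.
have [->|[x Ax]] := set_0Vmem A; first by rewrite cards0.
have [Agx ggx gx] := gA x Ax.
have Agx' : g x \in A :\ x by rewrite !inE gx.
rewrite (cardsD1 x) Ax (cardsD1 (g x)) Agx' /= negbK.
apply: IHm => [|y].
  by move: leAm; rewrite (cardsD1 x) Ax (cardsD1 (g x)) Agx'; lia.
rewrite !inE => /and3P[ygx yx Ay]; have [Agy ggy gy] := gA y Ay; split=> //.
rewrite Agy andbT; apply/andP; split.
  by apply: contraNneq yx => e; rewrite -ggy e ggx.
by apply: contraNneq ygx => e; rewrite -e ggy.
Qed.

(** When [f] labels the vertices of a cell, the facet opposite [i] carries every label except [c]
    exactly once. *)
Definition door {T : finType} (c : T) (f : T -> T) (i : T) : bool :=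
  [forall j, (j != i) ==> (f j != c)] &&
  [forall j, forall j', [&& j != i, j' != i & f j == f j'] ==> (j == j')].

Lemma doorP {T : finType} (c : T) (f : T -> T) (i : T) :
  reflect ((forall j, j != i -> f j != c) /\
           (forall j j', j != i -> j' != i -> f j = f j' -> j = j'))
          (door c f i).
Proof.
apply: (iffP andP) => -[fc finj]; split.
- by move=> j; apply/implyP; apply: (forallP fc).
- move=> j j' ji j'i e; apply/eqP.
  by have /forallP/(_ j')/implyP := forallP finj j; apply; rewrite ji j'i e eqxx.
- by apply/forallP => j; apply/implyP => /fc.
- apply/forallP => j; apply/forallP => j'; apply/implyP => /and3P[ji j'i /eqP e].
  exact/eqP/finj.
Qed.

(** An injective [f] has one door, the preimage of [c]. Otherwise a door [i] repeats the label of
    exactly one other [j], and [i] and [j] are the only doors. *)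
Lemma odd_card_doors {T : finType} (c : T) (f : T -> T) :
  odd #|[set i | door c f i]| = injectiveb f.
Proof.
case: injectiveP => [finj | fNinj].
  have [g fK gK] := injF_bij finj.
  suff -> : [set i | door c f i] = [set g c] by rewrite cards1.
  apply/setP => i; rewrite !inE; apply/doorP/eqP => [[fc _]|->].
    by apply/eqP; rewrite eq_sym; case: eqVneq => // /fc; rewrite gK eqxx.
  split=> [j|j j' _ _ /finj //].
  by apply: contraNneq => <-; rewrite fK.
have [-> | [i]] := set_0Vmem [set i | door c f i]; first by rewrite cards0.
rewrite inE => /doorP[fc finj].
have [j [ji fj]] : exists j, j != i /\ f j = f i.
  have /injectivePn[x [y xy fxy]] : ~~ injectiveb f by apply/injectiveP.
  have [xi | xi] := eqVneq x i; first by exists y; rewrite -xi eq_sym xy.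
  have [yi | yi] := eqVneq y i; first by exists x; rewrite -yi xy.
  by rewrite (finj x y xi yi fxy) eqxx in xy.
suff -> : [set i | door c f i] = [set i; j] by rewrite cards2 eq_sym ji.
apply/setP => l; rewrite !inE; apply/doorP/orP => [[_ linj] | [] /eqP->].
- apply/orP; rewrite -[_ || _]negbK negb_or; apply/negP => /andP[li lj].
  by move: ji; rewrite (linj j i _ _ fj) ?eqxx // eq_sym.
- by split.
have fic : f i != c by rewrite -fj fc.
split=> [l' _|x y xj yj fxy].
  by have [-> //|] := eqVneq l' i; apply: fc.
have [xi | xi] := eqVneq x i; have [yi | yi] := eqVneq y i.
- by rewrite xi yi.
- by case/negP: yj; apply/eqP/finj; rewrite // fj -xi fxy.
- by case/negP: xj; apply/eqP/finj; rewrite // fj -yi fxy.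
exact: finj.
Qed.

(** * Cells of the triangulation and their pivots *)

Section Cells.
Variables (n N : nat).
Notation K := n.+2.
Notation vertex := {ffun 'I_K -> 'I_N.+1}.
Notation cell := {ffun 'I_K -> vertex}.
Implicit Types (s : cell) (z : vertex) (i j b c : 'I_K) (t : {perm 'I_K}).

(* Indices are cyclic: the edge from [s i] to [s (i + 1)] moves one unit from coordinate
   [t i - 1] to coordinate [t i]; both sides are shifted to avoid subtraction. *)
Definition steps t s : bool :=
  [forall i, forall b, s (i + 1)%R b + (t i == b + 1)%R == s i b + (t i == b)].

Lemma stepsP t s :
  reflect (forall i b, s (i + 1)%R b + (t i == b + 1)%R = s i b + (t i == b))
          (steps t s).
Proof.
apply: (iffP forallP) => H i; first by move=> b; apply/eqP; apply: (forallP (H i)).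
by apply/forallP => b; apply/eqP.
Qed.

(* The owner grows by 1 along each edge of a cell. Indexing the vertices of a cell by
   their owners makes its representation unique. *)
Definition owner z : 'I_K := (\sum_b b *+ z b)%R.

Definition is_cell s : bool :=
  [exists t, steps t s] &&
  [forall i, (\sum_b s i b == N) && (owner (s i) == i)].

Lemma is_cellP s :
  reflect [/\ exists t, steps t s, forall i, \sum_b s i b = N
            & forall i, owner (s i) = i] (is_cell s).
Proof.
apply: (iffP andP) => [[/existsP st /forallP H]|[st sN so]]; split=> //.
- by move=> i; have /andP[/eqP] := H i.
- by move=> i; have /andP[_ /eqP] := H i.
- exact/existsP.
by apply/forallP => i; rewrite sN so !eqxx.
Qed.

Lemma ordS1_neq i : (i + 1)%R != i.
Proof. by rewrite -subr_eq0 addrAC subrr add0r oner_eq0. Qed.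

Lemma ordP1_neq i : (i - 1)%R != i.
Proof. by rewrite -subr_eq0 addrAC subrr add0r oppr_eq0 oner_eq0. Qed.

Lemma ord_cyclic_ind (P : 'I_K -> Prop) i0 :
  P i0 -> (forall i, P i -> P (i + 1)%R) -> forall i, P i.
Proof.
move=> P0 PS i.
have -> : i = (i0 + (nat_of_ord (i - i0)%R)%:R)%R by rewrite natr_Zp addrC subrK.
elim: (nat_of_ord _) => [|m IHm]; first by rewrite addr0.
by rewrite mulrSr addrA; apply: PS.
Qed.

(** Coordinate [b] rises at step [t^-1 b] and falls at step [t^-1 (b + 1)]; comparing with [i] tells
    whether that step lies on the way from [s 0] to [s i]. *)
Lemma steps_closed t s i b : steps t s ->
  s i b + ((t^-1)%g (b + 1)%R < i) = s ord0 b + ((t^-1)%g b < i).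
Proof.
move/stepsP => st; case: i => m; elim: m => [|m IHm] ltm.
  by rewrite /= !addn0; congr (val (s _ _)); apply: val_inj.
have lt'm := ltnW ltm.
have := st (Ordinal lt'm) b; have := IHm lt'm.
have -> : (Ordinal lt'm + 1)%R = Ordinal ltm.
  by apply: val_inj => /=; rewrite modnDmr addn1 modn_small.
have tE c : (t (Ordinal lt'm) == c) = ((t^-1)%g c == m :> nat).
  by rewrite -(inj_eq (@perm_inj _ (t^-1)%g)) permK eq_sym.
rewrite !tE /=.
move: (nat_of_ord ((t^-1)%g _)) (nat_of_ord ((t^-1)%g _)) => x y; lia.
Qed.

Lemma cell_range t s i j b : steps t s -> s i b <= (s j b).+1.
Proof.
move=> st; have := steps_closed t s i b st; have := steps_closed t s j b st.
move: (nat_of_ord ((t^-1)%g _)) (nat_of_ord ((t^-1)%g _)) => x y; lia.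
Qed.

Definition pivotable s i : bool :=
  [forall b, s i b <= s (i - 1)%R b + s (i + 1)%R b].

(** Reflects vertex [i] through the midpoint of its cyclic neighbours, which gives the adjacent cell
    across the opposite facet. *)
Definition pivot s i : cell :=
  [ffun j => if j == i then
     [ffun b => inord (s (i - 1)%R b + s (i + 1)%R b - s i b)] else s j].

Lemma pivot_neq s i j : j != i -> pivot s i j = s j.
Proof. by rewrite ffunE => /negPf->. Qed.

(** [pivotable] makes the subtraction exact, and [inord] does not overflow because the coordinates
    of each vertex sum to [N]. *)
Lemma pivotE s i b : is_cell s -> pivotable s i ->
  pivot s i i b + s i b = s (i - 1)%R b + s (i + 1)%R b.
Proof.
case/is_cellP => _ sN _ /forallP pv.
rewrite !ffunE eqxx ffunE inordK ?subnK //.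
have := sN (i - 1)%R; have := sN (i + 1)%R; have := sN i.
have D z : \sum_c z c = z b + \sum_(c | c != b) z c by rewrite (bigD1 b).
rewrite !D; set x := \sum_(_ | _) _; set y := \sum_(_ | _) _.
set w := \sum_(_ | _) _ => ex ey ew.
suff : x <= y + w by have := pv b; lia.
by rewrite addnC -big_split; apply: leq_sum => j _; apply: pv.
Qed.

(** Reflecting vertex [i] exchanges the steps into and out of it. *)
Lemma pivot_steps t s i : is_cell s -> pivotable s i -> steps t s ->
  steps (tperm (i - 1)%R i * t)%g (pivot s i).
Proof.
move=> cs pv st; apply/stepsP => j b; rewrite permM.
have stE := elimT (stepsP t s) st.
have := stE (i - 1)%R b; have := stE i b; rewrite subrK.
have := pivotE s i b cs pv.
have [-> | ji] := eqVneq j i.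
  by rewrite tpermR (pivot_neq s i (i + 1)%R) ?ordS1_neq //; lia.
have [-> | ji'] := eqVneq j (i - 1)%R.
  by rewrite tpermL subrK (pivot_neq s i (i - 1)%R) ?ordP1_neq //; lia.
have jS : (j + 1)%R != i by apply: contraNneq ji' => <-; rewrite addrK.
have -> : tperm (i - 1)%R i j = j by apply: tpermD; rewrite eq_sym.
by move=> _ _ _; rewrite !pivot_neq.
Qed.

Lemma pivot_cell s i : is_cell s -> pivotable s i -> is_cell (pivot s i).
Proof.
move=> cs pv; have [[t st] sN so] := is_cellP s cs.
apply/is_cellP; split.
- by exists (tperm (i - 1)%R i * t)%g; apply: pivot_steps.
- move=> j; have [-> | ji] := eqVneq j i; last by rewrite pivot_neq.
  apply: (@addIn (\sum_b s i b)); rewrite -big_split /=.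
  under eq_bigr => b _ do rewrite pivotE //.
  by rewrite big_split /= !sN.
move=> j; have [-> | ji] := eqVneq j i; last by rewrite pivot_neq.
apply: (@addIr _ (owner (s i))); rewrite /owner -big_split /=.
under eq_bigr => b _ do rewrite -mulrnDr pivotE // mulrnDr.
by rewrite big_split /= -!/(owner _) !so addrACA addNr addr0.
Qed.

Lemma pivotable_pivot s i : is_cell s -> pivotable s i -> pivotable (pivot s i) i.
Proof.
move=> cs pv; apply/forallP => b.
rewrite !(pivot_neq _ _ (_ + _)%R) ?ordS1_neq ?ordP1_neq //.
by have := pivotE s i b cs pv; lia.
Qed.

Lemma pivotK s i : is_cell s -> pivotable s i -> pivot (pivot s i) i = s.
Proof.
move=> cs pv; apply/ffunP => j; apply/ffunP => b; apply: val_inj => /=.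
have [-> | ji] := eqVneq j i; last by rewrite !pivot_neq.
have := pivotE s i b cs pv.
have := pivotE _ i b (pivot_cell s i cs pv) (pivotable_pivot s i cs pv).
rewrite !(pivot_neq _ _ (_ + _)%R) ?ordS1_neq ?ordP1_neq //; lia.
Qed.

Lemma pivot_id_neq s i : is_cell s -> pivotable s i -> pivot s i != s.
Proof.
move=> cs pv; have [[t /stepsP st] _ _] := is_cellP s cs.
apply/eqP => e; have := pivotE s i (t i) cs pv; rewrite e.
have := st (i - 1)%R (t i); have := st i (t i).
rewrite subrK eqxx (inj_eq perm_inj) (negPf (ordP1_neq i)).
by rewrite [t i == _]eq_sym (negPf (ordS1_neq _)); lia.
Qed.

(** If the reflected coordinate [b] would be negative, then, coordinates varying by at most 1 in a
    cell, it is 1 at [i] and 0 at both neighbours. Its only rise and fall are the steps next to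
    [i]. *)
Lemma not_pivotable_face s i : is_cell s -> ~~ pivotable s i ->
  exists b, forall j, j != i -> s j b = ord0.
Proof.
case/is_cellP=> -[t st] _ _; rewrite negb_forall => /existsP[b].
have := cell_range t s i (i - 1)%R b st; have := cell_range t s i (i + 1)%R b st.
move/stepsP: st => st ru rd lt.
exists b; apply: (ord_cyclic_ind _ i) => [|j IH jS]; first by rewrite eqxx.
apply: val_inj => /=; have := st (i - 1)%R b; have := st i b; rewrite subrK => s1 s2.
have [ji | ji] := eqVneq j i; first by rewrite ji; lia.
have := IH ji => /(congr1 val) /= sj; have := st j b; rewrite sj.
suff -> : (t j == b) = false by lia.
have tb : t (i - 1)%R = b by apply/eqP; lia.
apply: contraNF jS => /eqP tj.
by rewrite (_ : j = i - 1)%R ?subrK //; apply: (@perm_inj _ t); rewrite tj tb.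
Qed.

(** * Doors and boundary labels *)

Definition full (L : vertex -> 'I_K) : {set cell} :=
  [set s | is_cell s && injectiveb (L \o s)].

Definition doors (L : vertex -> 'I_K) : {set cell * 'I_K} :=
  [set p | is_cell p.1 && door ord_max (L \o p.1) p.2].

Lemma odd_doors L : odd #|doors L| = odd #|full L|.
Proof.
have -> : #|doors L| = \sum_(s | is_cell s) #|[set i | door ord_max (L \o s) i]|.
  rewrite -sum1dep_card -(pair_big_dep is_cell
    (fun s i => door ord_max (L \o s) i) (fun _ _ => 1)) /=.
  by apply: eq_bigr => s _; rewrite sum1dep_card.
have -> : #|full L| = \sum_(s | is_cell s) injectiveb (L \o s).
  by rewrite -sum1dep_card big_mkcondr; apply: eq_bigr => s _; case: injectiveb.
rewrite !(big_morph odd oddD (erefl _)); apply: eq_bigr => s _.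
by rewrite odd_card_doors; case: injectiveb.
Qed.

(** Pivoting pairs off the doors at pivotable facets; the others lie on the boundary, where both
    labellings agree. *)
Lemma odd_full_face (L1 L2 : vertex -> 'I_K) :
  (forall z b, z b = ord0 -> L1 z = L2 z) -> odd #|full L1| = odd #|full L2|.
Proof.
move=> L12; pose B := [set p : cell * 'I_K | pivotable p.1 p.2].
have ev L : ~~ odd #|doors L :&: B|.
  apply: (@odd_card_involution _ _ (fun p => (pivot p.1 p.2, p.2))) => -[s i].
  rewrite !inE /= => /andP[/andP[cs /doorP[dc di]] pv]; split.
  - rewrite pivot_cell ?pivotable_pivot //= andbT.
    apply/doorP; split=> [j ji|j j' ji j'i]; rewrite /= !pivot_neq //.
      exact: dc.
    exact: di.
  - by rewrite pivotK.
  by rewrite xpair_eqE eqxx andbT pivot_id_neq.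
rewrite -!odd_doors -(cardsID B (doors L1)) -(cardsID B (doors L2)) !oddD.
rewrite !(negPf (ev _)) /=; congr (odd #|pred_of_set _|).
apply/setP => -[s i]; rewrite !inE /=; case: (boolP (pivotable s i)) => //= pv.
case: (boolP (is_cell s)) => //= cs.
have [b sb] := not_pivotable_face s i cs pv.
have eqL j : j != i -> L1 (s j) = L2 (s j) by move/sb; apply: L12.
apply/doorP/doorP => -[dc di]; split=> [j ji|j j' ji j'i] /=.
- by rewrite -eqL //; apply: dc.
- by rewrite -!eqL //; apply: di.
- by rewrite eqL //; apply: dc.
by rewrite !eqL //; apply: di.
Qed.

(** * The labelling [first_big] and its only full cell *)

Definition first_big z : 'I_K :=
  odflt ord0 [pick b | (1 < z b) && [forall c : 'I_K, (c < b) ==> (z c <= 1)]].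

Lemma ltn_ord_max c : c != ord_max -> c < (ord_max : 'I_K).
Proof. by move=> cm; rewrite ltn_neqAle -ltnS ltn_ord andbT. Qed.

Lemma exists_big z : K < \sum_b z b -> exists b, 1 < z b.
Proof.
move=> zN; apply/existsP; rewrite -[X in is_true X]negbK negb_exists.
apply: contraTN zN => /forallP z1; rewrite -leqNgt -[leqRHS]card_ord -sum1_card.
by apply: leq_sum => b _; rewrite leqNgt.
Qed.

Lemma first_bigP z : K < \sum_b z b ->
  1 < z (first_big z) /\ forall c, c < first_big z -> z c <= 1.
Proof.
move=> /exists_big[b0 b0P]; rewrite /first_big.
case: pickP => [b /andP[-> /forallP bP]|noP] /=.
  by split=> // c; apply/implyP.
have [b bP bmin] := @arg_minnP _ b0 (fun b => 1 < z b) (@nat_of_ord K) b0P.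
have := noP b; rewrite bP /= => /negbT/negP[]; apply/forallP => c; apply/implyP.
by apply: contraTT; rewrite -!ltnNge ltnS; apply: bmin.
Qed.

Section FullCorner.
Hypothesis ltKN : K < N.

Definition corner b : vertex :=
  [ffun c : 'I_K => inord ((if c == ord_max then N - K else 1) + (c == b))].

Lemma cornerE b c : corner b c = (if c == ord_max then N - K else 1) + (c == b) :> nat.
Proof. by rewrite !ffunE inordK //; case: ifP; case: eqP => //=; lia. Qed.

Lemma sum_corner b : \sum_c corner b c = N.
Proof.
under eq_bigr => c _ do rewrite cornerE.
rewrite big_split /= -big_mkcond /= sum1_card card1.
rewrite (bigD1 ord_max) //= eqxx (eq_bigr (fun=> 1)); last by move=> c /negPf->.
by rewrite sum1_card cardC1 card_ord /=; lia.
Qed.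

Definition corner_owner : 'I_K :=
  (\sum_(c : 'I_K) c *+ (if c == ord_max then N - K else 1)%N)%R.

Lemma owner_corner b : owner (corner b) = (corner_owner + b)%R.
Proof.
rewrite /owner; under eq_bigr => c _ do rewrite cornerE mulrnDr.
rewrite big_split /=; congr +%R.
rewrite (bigD1 b) //= eqxx mulr1n big1 ?addr0 // => c /negPf->; exact: mulr0n.
Qed.

Definition corner_cell : cell := [ffun i => corner (i - corner_owner)%R].

Lemma corner_cellE i : corner_cell i = corner (i - corner_owner)%R.
Proof. by rewrite /corner_cell ffunE. Qed.

Lemma first_big_corner b : first_big (corner b) = b.
Proof.
have [|fb1 fbc] := first_bigP (corner b); first by rewrite sum_corner.
have [fm | fm] := eqVneq (first_big (corner b)) ord_max.
  apply/eqP; apply: contraTT isT => fb.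
  have bm : b != ord_max by rewrite -fm eq_sym.
  by have := fbc b; rewrite fm cornerE (negPf bm) eqxx ltn_ord_max // => /(_ isT).
by move: fb1; rewrite cornerE (negPf fm); case: eqP.
Qed.

Lemma corner_cell_full : corner_cell \in full first_big.
Proof.
rewrite inE; apply/andP; split; last first.
  apply/injectiveP => i j /=; rewrite !corner_cellE !first_big_corner.
  exact: addIr.
apply/is_cellP; split=> [|i|i].
- exists (perm (@addIr _ (1 - corner_owner)%R)).
  apply/stepsP => i b; rewrite !corner_cellE !cornerE permE addrA.
  have -> : (i + 1 - corner_owner = i - corner_owner + 1)%R by rewrite addrAC.
  set x := (i - corner_owner)%R.
  rewrite (inj_eq (@addIr _ 1%R)) [b == (x + 1)%R]eq_sym [b == x]eq_sym.
  exact: addnAC.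
- by rewrite corner_cellE sum_corner.
by rewrite corner_cellE owner_corner addrC subrK.
Qed.

(** In a full cell each [c] is [first_big] somewhere, so all coordinates but the last stay positive.
    The vertex labelled [ord_max] must then be [corner ord_max], and the steps from there are
    forced. *)
Lemma full_first_big : full first_big = [set corner_cell].
Proof.
apply/setP => s; rewrite in_set1; apply/idP/eqP => [sF|->]; last exact: corner_cell_full.
move: sF; rewrite inE => /andP[cs /injectiveP sinj].
have [[t st] sN so] := is_cellP s cs.
have [g _ gK] := injF_bij sinj.
have gE c : first_big (s (g c)) = c := gK c.
have fbP i : 1 < s i (first_big (s i)) /\ forall c, c < first_big (s i) -> s i c <= 1.
  by apply: first_bigP; rewrite sN.
have sge i c : c != ord_max -> 1 <= s i c.
  move=> cm; have [+ _] := fbP (g c); rewrite gE => sc.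
  by rewrite -ltnS; apply: leq_trans sc (cell_range t s (g c) i c st).
have sP : s (g ord_max) = corner ord_max.
  have low c : c != ord_max -> s (g ord_max) c = 1 :> nat.
    move=> cm; have [_ /(_ c)] := fbP (g ord_max); rewrite gE ltn_ord_max // => /(_ isT).
    by have := sge (g ord_max) c cm; lia.
  apply/ffunP => c; apply: val_inj; rewrite /= cornerE.
  have [->|cm] := eqVneq c ord_max; last by rewrite low.
  have := sN (g ord_max); rewrite (bigD1 ord_max) //= (eq_bigr (fun=> 1)) //.
  by rewrite sum1_card cardC1 card_ord /=; lia.
have stE := elimT (stepsP t s) st.
have oppr1 : (0 - 1)%R = ord_max :> 'I_K.
  apply/eqP; rewrite subr_eq eq_sym; apply/eqP/val_inj => /=.
  by rewrite addn1 modnn.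
(* Starting from the corner, every step around the cell is forced. *)
have forced i d : s i = corner (d - 1)%R -> t i = d \/ t i = 0%R.
  move=> si; pose c := (t i - 1)%R; have tc : t i = (c + 1)%R by rewrite subrK.
  have := stE i c; rewrite tc eqxx (negPf (ordS1_neq c)) si cornerE.
  have [->|cm] := eqVneq c ord_max; first by rewrite -oppr1 subrK; right.
  have := sge (i + 1)%R c cm; have [-> |_] := eqVneq c (d - 1)%R; last first.
    by case: (nat_of_ord (s (i + 1)%R c)) => [//|x] _; rewrite addn1 !addn0.
  by rewrite subrK; left.
have next i d : s i = corner (d - 1)%R -> t i = d -> s (i + 1)%R = corner d.
  move=> si ti; apply/ffunP => b; apply: val_inj => /=.
  have := stE i b; rewrite si ti !cornerE [b == (d - 1)%R]eq_sym subr_eq.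
  by rewrite [b == d]eq_sym addnAC => /addIn.
(* With [d = 0] the two alternatives of [forced] coincide. *)
have t0 : t (g ord_max) = 0%R by case: (forced (g ord_max) 0%R) => //; rewrite oppr1.
have walk m : m < K ->
    s (g ord_max + m%:R)%R = corner (m%:R - 1)%R /\ t (g ord_max + m%:R)%R = m%:R%R.
  elim: m => [|m IHm] ltm; first by rewrite addr0 oppr1.
  have [sm tm] := IHm (ltnW ltm).
  have sS : s (g ord_max + m.+1%:R)%R = corner (m.+1%:R - 1)%R.
    by rewrite mulrSr addrA (next _ _ sm tm) addrK.
  (* A second step with value 0 would contradict the injectivity of [t]. *)
  split=> //; have [// | t0'] := forced _ _ sS.
  have /eqP := perm_inj (etrans t0' (esym t0)).
  rewrite -subr_eq0 addrAC subrr add0r => /eqP/(congr1 val).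
  by rewrite /= Zp_nat /= modn_small.
have sE i : s i = corner (i - g ord_max - 1)%R.
  have [+ _] := walk (i - g ord_max)%R (ltn_ord _).
  by rewrite natr_Zp addrC subrK.
apply/ffunP => i; rewrite corner_cellE sE; congr corner.
have := so (g ord_max); rewrite sP owner_corner -oppr1 sub0r => <-.
by rewrite opprD opprK addrAC -!addrA; congr (_ + _)%R; rewrite addrC -addrA subrr addr0.
Qed.
End FullCorner.

(** [L] is replaced by [first_big] on the boundary. In a full cell of the result every coordinate
    exceeds 1 at some vertex, hence is positive throughout, so only labels of [L] occur. *)
Theorem sperner (L : vertex -> 'I_K) : K < N ->
  (forall z, \sum_b z b = N -> (forall b, 0 < z b) -> 1 < z (L z)) ->
  exists s, [/\ is_cell s, forall i b, 0 < s i b & injective (L \o s)].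
Proof.
move=> ltKN LP.
pose L' z := if [forall b, 0 < z b] then L z else first_big z.
have : odd #|full L'|.
  rewrite (odd_full_face L' first_big); first by rewrite full_first_big ?cards1.
  move=> z b zb; rewrite /L'; case: ifP => // /forallP/(_ b); by rewrite zb.
have L'P z : \sum_b z b = N -> 1 < z (L' z).
  move=> zN; rewrite /L'; case: ifP => [/forallP z0|_]; first exact: LP.
  by have [] := first_bigP z; rewrite ?zN.
have [->|[s]] := set_0Vmem (full L'); first by rewrite cards0.
rewrite inE => /andP[cs /injectiveP sinj] _; have [[t st] sN _] := is_cellP s cs.
have spos i b : 0 < s i b.
  have [g _ gK] := injF_bij sinj.
  have gE : L' (s (g b)) = b := gK b.
  have := L'P _ (sN (g b)); rewrite gE -[0 < _]ltnS => sb.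
  exact: leq_trans sb (cell_range t s (g b) i b st).
exists s; split=> // i j e; apply: sinj; rewrite /= /L'.
by have /forallP -> := spos i; have /forallP -> := spos j.
Qed.

End Cells.

(** * Voting and knife positions on the line *)

Lemma plurality (q k : nat) (fav : 'I_q -> 'I_k) : 0 < q ->
  exists a, q <= k * #|[set a' | fav a' == fav a]|.
Proof.
move=> q0; pose cnt b := #|[set a | fav a == b]|.
have [b _ bmax] := @arg_maxnP _ (fav (Ordinal q0)) predT cnt isT.
have le_q : q <= k * cnt b.
  rewrite -[leqLHS]card_ord -sum1_card (partition_big fav predT) //=.
  rewrite -[k in leqRHS]card_ord -sum_nat_const; apply: leq_sum => b' _.
  by rewrite sum1dep_card; apply: bmax.
have [e|[a]] := set_0Vmem [set a | fav a == b].
  by move: le_q; rewrite /cnt e cards0 muln0 leqNgt q0.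
by rewrite inE => /eqP ab; exists a; rewrite ab.
Qed.

Lemma between_cuts (r : nat -> nat) (k x : nat) :
  r 0 = 0 -> x < r k -> exists j : 'I_k, r j <= x < r j.+1.
Proof.
move=> r0; elim: k => [|k IHk] xk; first by rewrite r0 in xk.
have [/IHk[j jP]|kx] := ltnP x (r k); first by exists (widen_ord (leqnSn k) j).
by exists ord_max; rewrite kx.
Qed.

Section Cuts.
Variables (n N : nat).
Notation K := n.+2.
Notation vertex := {ffun 'I_K -> 'I_N.+1}.
Notation cell := {ffun 'I_K -> vertex}.
Implicit Types (s : cell) (z : vertex) (i j b : 'I_K).

(* Position of the [m]-th knife. Since the cells live in the region where all
   coordinates are positive, piece [b] has length [z b - 1]. *)
Definition cut z (m : nat) : nat := \sum_(0 <= l < m) (z l%:R%R).-1.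

Lemma cutS z b : cut z b.+1 = cut z b + (z b).-1.
Proof. by rewrite /cut big_nat_recr //= natr_Zp. Qed.

Lemma leq_cut z (m : nat) : cut z m <= cut z m.+1.
Proof. by rewrite /cut big_nat_recr //= leq_addr. Qed.

Lemma cut_full z : \sum_b z b = N -> (forall b, 0 < z b) -> cut z K = N - K.
Proof.
move=> zN z0; suff : cut z K + K = \sum_b z b by rewrite zN => <-; rewrite addnK.
rewrite /cut big_mkord -[X in _ + X]card_ord -sum1_card -big_split /=.
by apply: eq_bigr => b _; rewrite natr_Zp addn1 prednK.
Qed.

(** The sum of coordinates [0] to [m - 1] telescopes: knife [m] can advance only at step [t^-1 0]
    and retreat only at step [t^-1 m]. *)
Lemma cut_range s i j (m : nat) : is_cell n N s -> (forall i b, 0 < s i b) ->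
  cut (s i) m <= (cut (s j) m).+1.
Proof.
case/is_cellP => -[t st] _ _ s0.
have E i' : cut (s i') m + ((t^-1)%g m%:R%R < i') = cut (s ord0) m + ((t^-1)%g 0%R < i').
  elim: m => [|m IHm]; first by rewrite /cut !big_geq.
  have := steps_closed n N t s i' m%:R%R st; have := s0 i' m%:R%R.
  have := s0 ord0 m%:R%R; move: IHm; rewrite /cut !big_nat_recr //= -mulrSr.
  set x := s i' _; set y := s ord0 _; set a := _ < i'; set b := _ < i'; set c := _ < i'.
  set X := \sum_(_ <= _ < _) _; set Y := \sum_(_ <= _ < _) _.
  by move: (nat_of_ord x) (nat_of_ord y) a b c X Y; lia.
have := E i; have := E j; move: (nat_of_ord ((t^-1)%g _)) (nat_of_ord ((t^-1)%g _)).
by move: (cut _ _) (cut _ _) (cut _ _); lia.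
Qed.

Variable G : finType.
Implicit Types (g : G).

(* A good of rank [r] occupies the interval [2 r, 2 r + 2]; it is lost when a knife
   lies strictly inside. *)
Definition share z b : {set G} :=
  [set g | (cut z b <= (enum_rank g).*2) && ((enum_rank g).+1.*2 <= cut z b.+1)].

Lemma share_thin z b : z b <= 1 -> share z b = set0.
Proof.
move=> zb; apply/setP => g; rewrite !inE cutS; apply/negP => /andP[]; lia.
Qed.

Definition votes (R : realFieldType) (q : nat) (v : 'I_q -> {set G} -> R) z b : {set 'I_q} :=
  [set a | [forall b', v a (share z b') <= v a (share z b)]%R].

Lemma vote (R : realFieldType) (q : nat) (v : 'I_q -> {set G} -> R) z :
  0 < q -> (forall a, monotone_util (v a)) -> K < \sum_b z b ->
  exists2 b, 1 < z b & q <= K * #|votes R q v z b|.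
Proof.
move=> q0 vmon zN; have [b0 b0P] := exists_big n N z zN.
(* A coordinate at most 1 gives an empty share, so by monotonicity some favourite has coordinate
   above 1, as [sperner] requires. *)
pose fav a := [arg max_(b > b0 | 1 < z b) v a (share z b)]%O.
have favP a : 1 < z (fav a) /\ forall b, (v a (share z b) <= v a (share z (fav a)))%R.
  rewrite /fav; case: Order.TotalTheory.arg_maxP => // b bP bmax; split=> // b'.
  have [b'P|b'P] := ltnP 1 (z b'); first exact: bmax.
  by rewrite share_thin //; apply: vmon; apply: sub0set.
have [a qa] := plurality q K fav q0.
exists (fav a); first by have [] := favP a.
apply: leq_trans qa _; rewrite leq_mul2l; apply/orP; right.
apply/subset_leq_card/subsetP => a'; rewrite !inE => /eqP <-.
by apply/forallP; have [] := favP a'.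
Qed.

(** * Rounding the knives of a Sperner cell *)

Section Rounding.
Variable s : cell.
Hypotheses (cs : is_cell n N s) (s0 : forall i b, 0 < s i b).
Hypothesis ltGN : #|G|.*2 < N - K.

Definition low_cut (m : nat) : nat := cut (s [arg min_(i < ord0) cut (s i) m]) m.

Lemma low_cut_le i m : low_cut m <= cut (s i) m.
Proof. by rewrite /low_cut; case: arg_minnP => // j _; apply. Qed.

Lemma cut_le_low i m : cut (s i) m <= (low_cut m).+1.
Proof. exact: cut_range. Qed.

Lemma leq_low_cut : {homo low_cut : m p / m <= p}.
Proof.
apply: homo_leq => [//|m p q|m]; first exact: leq_trans.
by rewrite [low_cut m.+1]/low_cut; apply: leq_trans (low_cut_le _ _) (leq_cut _ _).
Qed.

(** One of the positions [low_cut m] and [low_cut m + 1] is even, hence a boundary between goods;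
    this is its half. *)
Definition round_cut (m : nat) : nat := uphalf (low_cut m).

Lemma leq_round_cut : {homo round_cut : m p / m <= p}.
Proof. by move=> m p /leq_low_cut; apply: uphalf_leq. Qed.

Lemma exists_piece g : exists b, round_cut b <= enum_rank g < round_cut b.+1.
Proof.
apply: between_cuts; first by rewrite /round_cut /low_cut /cut big_geq.
have [_ sN _] := is_cellP n N s cs.
(* The last knife stands at [N - K], to the right of all goods. *)
rewrite /round_cut /low_cut cut_full // gtn_uphalf_double.
by apply: leq_ltn_trans ltGN; rewrite leq_double ltnW.
Qed.

Definition piece g : 'I_K :=
  odflt ord0 [pick b : 'I_K | round_cut b <= enum_rank g < round_cut b.+1].

Lemma pieceE g b : (piece g == b) = (round_cut b <= enum_rank g < round_cut b.+1).
Proof.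
have pP : round_cut (piece g) <= enum_rank g < round_cut (piece g).+1.
  rewrite /piece; case: pickP => //= noP.
  by have [b' b'P] := exists_piece g; have := noP b'; rewrite b'P.
apply/eqP/idP => [<- //|bP].
have {pP bP} : ~ (piece g < b) /\ ~ (b < piece g).
  by split=> /leq_round_cut; move: pP bP; lia.
by move=> [pb bp]; apply: val_inj => /=; lia.
Qed.

Lemma share_sub_piece i b : share (s i) b \subset [set g | piece g == b].
Proof.
apply/subsetP => g; rewrite !inE pieceE /round_cut.
have := low_cut_le i b; have := cut_le_low i b.+1; lia.
Qed.

Lemma piece_sub_share i b : exists C : {set G},
  [/\ C \subset [set g | piece g == b], #|C| <= 2
    & [set g | piece g == b] :\: C \subset share (s i) b].
Proof.
pose at_rank m := [set g : G | enum_rank g == m :> nat].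
have card_at m : #|at_rank m| <= 1.
  apply/card_le1_eqP => g g'; rewrite !inE => /eqP e /eqP e'.
  by apply: enum_rank_inj; apply: val_inj; rewrite /= e e'.
(* Only the two end goods of a rounded piece can be missing from the share at [s i]. *)
exists ([set g | piece g == b] :&: (at_rank (round_cut b) :|: at_rank (round_cut b.+1).-1)).
split; first exact: subsetIl.
  apply: leq_trans (subset_leq_card (subsetIr _ _)) _.
  by apply: leq_trans (leq_card_setU _ _) _; apply: (leq_add (card_at _) (card_at _)).
apply/subsetP => g; rewrite !inE.
case: (boolP (piece g == b)); rewrite pieceE ?andbF // /round_cut.
have := cut_le_low i b; have := low_cut_le i b.+1; lia.
Qed.

End Rounding.
End Cuts.

(** * The allocation read off a Sperner cell *)

Local Open Scope ring_scope.

Theorem mainTheorem16 (R : realFieldType) (G : finType) (k : nat)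
    (n : 'I_k -> nat) (u : forall i : 'I_k, 'I_(n i) -> {set G} -> R) :
  (2 <= k)%N ->
  (forall i, 0 < n i)%N ->
  (forall i a X, 0 <= u i a X) ->
  (forall i a, monotone_util (u i a)) ->
  exists alloc : G -> 'I_k, democratic_EF2 u alloc.
Proof.
case: k n u => [|[|k]] n u // _ n0 _ umon.
(* The piece lengths [z b - 1] add up to [N - k.+2], just above the length [#|G|.*2] of the line of
   goods. *)
pose N := (k.+2 + #|G|.*2.+1)%N.
have ltKN : (k.+2 < N)%N by rewrite /N; lia.
pose good (z : {ffun 'I_k.+2 -> 'I_N.+1}) b :=
  (1 < z b)%N && (n (owner k N z) <= k.+2 * #|votes k N G R _ (u (owner k N z)) z b|)%N.
pose L z := odflt ord0 [pick b | good z b].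
have LP (z : {ffun 'I_k.+2 -> 'I_N.+1}) : (\sum_b z b = N)%N -> good z (L z).
  move=> zN; rewrite /L; case: pickP => //= noP.
  have [|b zb qb] := vote k N G R _ (u (owner k N z)) z (n0 _) (umon _); first by rewrite zN.
  by have := noP b; rewrite /good zb qb.
have [|s [cs s0 sinj]] := sperner k N L ltKN.
  by move=> z zN _; have /andP[] := LP z zN.
have [_ sN so] := is_cellP k N s cs.
have ltGN : (#|G|.*2 < N - k.+2)%N by rewrite /N; lia.
(* [p b] owns the vertex labelled [b]; this group receives the rounded piece [b]. *)
have [p Lp pL] := injF_bij sinj.
exists (fun g => p (piece k N G s g)) => i.
have bundleE j : bundle (fun g => p (piece k N G s g)) j
    = [set g | piece k N G s g == L (s j)].
  by apply/setP => g; rewrite !inE; apply/eqP/eqP => [<-|->]; [rewrite [RHS]pL|apply: Lp].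
have /andP[_] := LP (s i) (sN i); rewrite so => le_n.
apply: leq_trans le_n _; rewrite leq_mul2l; apply/orP; right.
apply/subset_leq_card/subsetP => a; rewrite !inE => /forallP fav.
apply/forallP => j; rewrite !bundleE.
(* All comparisons take place at [s i], where [L (s i)] is a favourite of [a]: its rounded piece
   contains its share, while the bundle of [j] without [C] lies in the share of [L (s j)]. *)
have [C [CF C2 Csub]] := piece_sub_share k N G s cs s0 ltGN i (L (s j)).
apply/existsP; exists C; rewrite CF C2 /=.
apply: le_trans (umon i a _ _ Csub) _; apply: le_trans (fav _) _.
by apply: umon; apply: share_sub_piece.
Qed.
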